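(* Let $D\ge 1$ be an integer and let $L$ be a linear space of complex $D\times D$ matrices (a linear subspace of $\mathbb{C}^{D\times D}$). If $\dim L^k=D^2$ for some positive integer $k$, then $\dim L^k=D^2$ for all integers $k\geq 2D^2\left(6+\log_2 D\right)$.
   Context: For a linear subspace $L\subset\mathbb{C}^{D\times D}$ and a positive integer $k$, $L^k$ denotes the linear subspace of $\mathbb{C}^{D\times D}$ spanned by all products $A_1A_2\cdots A_k$ of exactly $k$ (not necessarily distinct) elements $A_1,\dots,A_k\in L$. Dimensions are over $\mathbb{C}$. *)

(* Defs.v *)
From mathcomp Require Import all_boot all_order all_algebra.
From mathcomp Require Import complex.
From mathcomp Require Import boolp classical_sets reals exp.

Set Implicit Arguments.
Unset Strict Implicit.
Unset Printing Implicit Defensive.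

Import Order.TTheory GRing.Theory Num.Theory.
Local Open Scope classical_set_scope.
Local Open Scope ring_scope.

(* The linear span of an arbitrary, possibly infinite, set of vectors. The
   library's span s covers only finite sequences s; v is in the span of S iff
   v is in span s for some finite sequence s of elements of S. *)
Lemma ex_set_span (F : fieldType) (V : vectType F) (S : set V) :
  exists W : {vspace V}, forall v : V,
    v \in W <-> exists2 s : seq V, {in s, forall x, S x} & v \in (span s).
Proof.
pose P n := `[< exists2 s : seq V, {in s, forall x, S x} & \dim (span s) = n >].
have exP : exists n, P n by exists 0%N; apply/asboolP; exists [::]; rewrite // span_nil dimv0.
have ubP n : P n -> (n <= \dim {:V})%N.
  by case/asboolP => s _ <-; apply: dimvS; apply: subvf.
case: (ex_maxnP exP ubP) => n /asboolP[s sS dims] maxn.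
exists (span s) => v; split=> [vs|[t tS vt]]; first by exists s.
have sub : (span s <= span (s ++ t))%VS by rewrite span_cat addvSl.
have : (\dim (span (s ++ t)) <= n)%N.
  apply: maxn; apply/asboolP; exists (s ++ t) => // x.
  by rewrite mem_cat => /orP[/sS|/tS].
rewrite -dims => le.
have /eqP -> : (span s) == (span (s ++ t)) by rewrite eqEdim sub.
by apply: subvP vt; rewrite span_cat addvSr.
Qed.

Definition set_span (F : fieldType) (V : vectType F) (S : set V) : {vspace V} :=
  sval (cid (ex_set_span S)).

Lemma set_spanP (F : fieldType) (V : vectType F) (S : set V) (v : V) :
  v \in set_span S <->
  exists2 s : seq V, {in s, forall x, S x} & v \in (span s).
Proof. exact: (svalP (cid (ex_set_span S))). Qed.

Definition mx_products (F : fieldType) (D : nat) (L : {vspace 'M[F]_D})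
    (k : nat) : set 'M[F]_D :=
  [set B | exists A : 'I_k -> 'M[F]_D,
     (forall i, A i \in L) /\ B = \big[mulmx/1%:M]_(i < k) A i].

Definition mxspace_pow (F : fieldType) (D : nat) (L : {vspace 'M[F]_D})
    (k : nat) : {vspace 'M[F]_D} :=
  set_span (mx_products L k).

Definition log2 (R : realType) (x : R) : R := ln x / ln 2.

(* Main.v *)
Require Import Defs.
From mathcomp Require Import all_boot all_order all_algebra.
From mathcomp Require Import complex.
From mathcomp Require Import boolp classical_sets reals exp.
From mathcomp Require Import zify lra.

(** Write [P n] for the span of the products of [n] elements of [L].  The
    argument works over an arbitrary field and has two independent halves.

    Spreading ([full_of_not_nilpotent]).  Suppose [P m] contains a matrix [z]
    that is not nilpotent, and let [r] be at least the rank of [z ^+ 2].  Some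
    [t] between [2] and [r + 1] is such that [z ^+ t] and [z ^+ t.+1] have the
    same rank.  The dimension of [P (m * n) *m z ^+ t] does not decrease with
    [n], because right multiplication by [z] is injective on the left ideal
    generated by [z ^+ t]; and once it fails to increase it is constant for
    ever, because left multiplication by [P m] commutes with right
    multiplication by [z].  So this left ideal, of dimension at most [D * r],
    is filled for some [n < D * r].  In the same way the row space of
    [z ^+ t], multiplied by [P (m * n)], grows to the space of all rows for
    some [n < D].  Multiplying the two, [P] is full from [2 * D * r * m] on.

    Descent ([full_of_low_rank]).  It remains to find a non-nilpotent element
    of some [P m] whose square has a rank [r] for which [m * r] is of order
    [D * log2 D].  Let [U] be nonzero in [P k], and take the least [J] such that
    [U *m X *m U] is nonzero for some [X] in [P J]; [X] may be taken to be a
    single product [w].  Cut [w] after its first [i] factors: the second part,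
    followed by [U], annihilates everything that rows of [U] reach in fewer
    than [i] steps, hence [U *m w *m U] has rank at most the number of new
    dimensions reached at step [i].  Summing over [i], the rank of
    [U *m w *m U] is at most [D / (J + 1)] ([exists_low_rank_return]).
    If [y := w *m U] is not nilpotent, spreading applies to it.  Otherwise let
    [q >= 2] be the least exponent with [U *m y ^+ q = 0], and replace [U] by
    [U *m y ^+ q.-1].  The rank is divided by at least [q]
    ([dim_nilpotent_chain]), whereas the product of length and rank grows by at
    most [D].  As the rank is at least halved each time, this happens at most
    [log2 D] times.  The resulting bound [2 * D ^ 2 * (2 + log2 D)] is within
    the required one. *)

Set Implicit Arguments.
Unset Strict Implicit.
Unset Printing Implicit Defensive.

Import Order.TTheory GRing.Theory Num.Theory.
Local Open Scope ring_scope.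

(** * Growth of dimensions *)

(** The pattern behind both saturation arguments: a sequence that cannot
    resume growing after a pause gains at least one unit per step until it
    has reached its final value. *)
Lemma growth_saturates (d : nat -> nat) (B : nat) :
  (forall n, d n <= d n.+1)%N ->
  (forall n, d n = d n.+1 -> d n.+1 = d n.+2) ->
  (exists N, (B <= d N)%N) ->
  forall n, (B <= n + d 0)%N -> (B <= d n)%N.
Proof.
move=> mono persist [N dN] n Bn.
have homo : {homo d : i j / (i <= j)%N} by exact: homo_leq leqnn leq_trans mono.
case: (leqP B (d n)) => // ltdn.
have strict i : (i < n)%N -> (d i < d i.+1)%N.
  move=> lt_in; rewrite ltn_neqAle mono andbT; apply/eqP => eqd.
  have const j : d (i + j)%N = d i /\ d (i + j).+1 = d i.
    elim: j => [|j [IH1 IH2]]; first by rewrite addn0 -eqd.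
    by rewrite addnS IH2; split=> //; rewrite -persist ?IH1 ?IH2.
  have : (d N <= d (i + N)%N)%N by apply: homo; apply: leq_addl.
  have := homo _ _ (ltnW lt_in); rewrite (const N).1; lia.
suff grow i : (i <= n)%N -> (i + d 0 <= d i)%N by have := grow n (leqnn n); lia.
elim: i => // i IH lt_in; have := strict i lt_in; have := IH (ltnW lt_in); lia.
Qed.

(** * Products of spaces of matrices *)

Lemma set_span_sub (F : fieldType) (V : vectType F) (S : set V) (W : {vspace V}) :
  (forall x, S x -> x \in W) -> (set_span S <= W)%VS.
Proof.
move=> SW; apply/subvP => v /set_spanP [s sS vs].
by move: v vs; apply/subvP/span_subvP => x /sS /SW.
Qed.

Lemma mem_set_span (F : fieldType) (V : vectType F) (S : set V) (x : V) :
  S x -> x \in set_span S.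
Proof.
move=> Sx; apply/set_spanP; exists [:: x]; last by rewrite memv_span ?mem_head.
by move=> y; rewrite inE => /eqP ->.
Qed.

(** The number of rows [m] is left free, so that the same map acts on row
    vectors and on square matrices. *)
Definition rmul {F : fieldType} (m : nat) {n p : nat} (A : 'M[F]_(n, p)) :
    'Hom('M[F]_(m, n), 'M[F]_(m, p)) :=
  linfun (mulmxr A).

(** Rectangular shapes let one operation cover products of powers of [L], the
    action of such powers on row vectors, and the left ideals written as
    columns times a space of rows. *)
Definition mxprodv {F : fieldType} {m n p : nat} (U : {vspace 'M[F]_(m, n)})
    (V : {vspace 'M[F]_(n, p)}) : {vspace 'M[F]_(m, p)} :=
  set_span [set B | exists u v, [/\ u \in U, v \in V & B = u *m v]]%classic.

Lemma rmulE (F : fieldType) (m n p : nat) (A : 'M[F]_(n, p)) (X : 'M[F]_(m, n)) :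
  rmul m A X = X *m A.
Proof. by rewrite lfunE. Qed.

Lemma rmul_comp (F : fieldType) (m n p q : nat) (A : 'M[F]_(n, p))
    (B : 'M[F]_(p, q)) (U : {vspace 'M[F]_(m, n)}) :
  (rmul m (A *m B) @: U = rmul m B @: (rmul m A @: U))%VS.
Proof.
rewrite -limg_comp; congr (_ @: _)%VS; apply/lfunP => X.
by rewrite comp_lfunE !rmulE mulmxA.
Qed.

Lemma memv_mxprod (F : fieldType) (m n p : nat) (U : {vspace 'M[F]_(m, n)})
    (V : {vspace 'M[F]_(n, p)}) u v :
  u \in U -> v \in V -> u *m v \in mxprodv U V.
Proof. by move=> uU vV; apply: mem_set_span; exists u, v. Qed.

Lemma mxprodv_sub (F : fieldType) (m n p : nat) (U : {vspace 'M[F]_(m, n)})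
    (V : {vspace 'M[F]_(n, p)}) (W : {vspace 'M[F]_(m, p)}) :
  (forall u v, u \in U -> v \in V -> u *m v \in W) -> (mxprodv U V <= W)%VS.
Proof. by move=> UVW; apply: set_span_sub => _ [u [v [uU vV ->]]]; apply: UVW. Qed.

Lemma mxprodvS (F : fieldType) (m n p : nat) (U U' : {vspace 'M[F]_(m, n)})
    (V V' : {vspace 'M[F]_(n, p)}) :
  (U <= U')%VS -> (V <= V')%VS -> (mxprodv U V <= mxprodv U' V')%VS.
Proof.
move=> /subvP sU /subvP sV; apply: mxprodv_sub => u v /sU uU /sV vV.
exact: memv_mxprod.
Qed.

Lemma mxprodvA (F : fieldType) (m n p q : nat) (U : {vspace 'M[F]_(m, n)})
    (V : {vspace 'M[F]_(n, p)}) (W : {vspace 'M[F]_(p, q)}) :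
  mxprodv U (mxprodv V W) = mxprodv (mxprodv U V) W.
Proof.
apply/eqP; rewrite eqEsubv; apply/andP; split; apply: mxprodv_sub.
  move=> u x uU xVW; pose f := linfun (mulmx u : 'M[F]_(n, q) -> 'M[F]_(m, q)).
  rewrite (_ : u *m x = f x); last by rewrite lfunE.
  rewrite memv_preim; apply: (subvP _ _ xVW); apply: mxprodv_sub => v w vV wW.
  by rewrite -memv_preim lfunE /= mulmxA !memv_mxprod.
move=> x w xUV wW; rewrite -rmulE memv_preim; apply: (subvP _ _ xUV).
apply: mxprodv_sub => u v uU vV.
by rewrite -memv_preim rmulE -mulmxA !memv_mxprod.
Qed.

(** Left multiplication by a space commutes with right multiplication by a
    matrix; this is what makes a pause in the growth permanent. *)
Lemma mxprodv_rmul (F : fieldType) (m n p q : nat) (U : {vspace 'M[F]_(m, n)})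
    (V : {vspace 'M[F]_(n, p)}) (A : 'M[F]_(p, q)) :
  mxprodv U (rmul n A @: V)%VS = (rmul m A @: mxprodv U V)%VS.
Proof.
apply/eqP; rewrite eqEsubv; apply/andP; split.
  apply: mxprodv_sub => u _ uU /memv_imgP [v vV ->].
  by rewrite rmulE mulmxA -rmulE memv_img ?memv_mxprod.
apply/subvP => _ /memv_imgP [x xUV ->]; rewrite memv_preim.
apply: (subvP _ _ xUV); apply: mxprodv_sub => u v uU vV.
by rewrite -memv_preim rmulE -mulmxA memv_mxprod // -rmulE memv_img.
Qed.

Lemma dim_mxprodv (F : fieldType) (m n p : nat) (U : {vspace 'M[F]_(m, n)})
    (V : {vspace 'M[F]_(n, p)}) :
  (\dim (mxprodv U V) <= \dim U * \dim V)%N.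
Proof.
pose s := [seq u *m v | u <- vbasis U, v <- vbasis V].
have -> : (\dim U * \dim V)%N = size s by rewrite size_allpairs !size_tuple.
apply: leq_trans (dim_span s); apply/dimvS/mxprodv_sub => u v uU vV.
rewrite (coord_vbasis uU) (coord_vbasis vV) mulmx_suml.
apply: memv_suml => i _; rewrite mulmx_sumr; apply: memv_suml => j _.
rewrite -scalemxAl -scalemxAr !memvZ // memv_span //; apply: allpairs_f.
  by rewrite mem_nth ?size_tuple.
by rewrite mem_nth ?size_tuple.
Qed.

Lemma mxprodv_colrow (F : fieldType) (n : nat) :
  mxprodv (fullv : {vspace 'cV[F]_n}) (fullv : {vspace 'rV[F]_n}) = fullv.
Proof.
apply/eqP; rewrite eqEsubv subvf; apply/subvP => X _.
rewrite [X]matrix_sum_delta; apply: memv_suml => i _; apply: memv_suml => j _.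
by rewrite memvZ // -(mul_delta_mx (0 : 'I_1)) memv_mxprod // memvf.
Qed.

Lemma mxprodv_full (F : fieldType) (m n p : nat) (U : {vspace 'M[F]_(1, n)}) :
  U != 0%VS -> mxprodv U (fullv : {vspace 'M[F]_(n, p)}) = fullv.
Proof.
rewrite -vpick0 => u0; apply/eqP; rewrite eqEsubv subvf; apply/subvP => x _.
have [j uj0] : exists j, vpick U 0 j != 0.
  apply/existsP; apply: contra_neqT u0 => /existsPn u0; apply/rowP => j.
  by rewrite mxE; apply/eqP/negbNE.
have -> : x = vpick U *m ((vpick U 0 j)^-1 *: (delta_mx j 0 *m x)).
  rewrite -scalemxAr mulmxA -colE [col _ _]mx11_scalar mxE mul_scalar_mx.
  by rewrite scalerA mulVf // scale1r.
by rewrite memv_mxprod ?memv_pick ?memvf.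
Qed.

(** * Powers of a space of matrices *)

Definition word {F : fieldType} {D : nat} (s : seq 'M[F]_D) : 'M[F]_D :=
  \prod_(A <- s) A.

Lemma mxspace_pow_word (F : fieldType) (D : nat) (L : {vspace 'M[F]_D})
    (s : seq 'M[F]_D) :
  {subset s <= L} -> word s \in mxspace_pow L (size s).
Proof.
move=> sL; apply: mem_set_span; exists (tnth (in_tuple s)).
split; first by move=> i; apply/sL/mem_tnth.
by rewrite /word big_tnth.
Qed.

Lemma mxspace_pow_sub (F : fieldType) (D : nat) (L : {vspace 'M[F]_D}) (k : nat)
    (W : {vspace 'M[F]_D}) :
  (forall s, size s = k -> {subset s <= L} -> word s \in W) ->
  (mxspace_pow L k <= W)%VS.
Proof.
move=> wW; apply: set_span_sub => _ [A [AL ->]].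
have -> : \big[mulmx/1%:M]_(i < k) A i = word [seq A i | i <- index_enum 'I_k].
  by rewrite /word big_map.
apply: wW => [|_ /mapP [i _ ->]]; last exact: AL.
by rewrite size_map [index_enum _]unlock -enumT size_enum_ord.
Qed.

Lemma mxspace_pow0 (F : fieldType) (D : nat) (L : {vspace 'M[F]_D}) :
  1 \in mxspace_pow L 0.
Proof.
have -> : 1 = word ([::] : seq 'M[F]_D) by rewrite /word big_nil.
exact: (@mxspace_pow_word _ _ _ [::]).
Qed.

Lemma mxspace_powD (F : fieldType) (D : nat) (L : {vspace 'M[F]_D}) (a b : nat) :
  mxprodv (mxspace_pow L a) (mxspace_pow L b) = mxspace_pow L (a + b).
Proof.
apply/eqP; rewrite eqEsubv; apply/andP; split.
  apply: mxprodv_sub => u v uL vL.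
  rewrite -rmulE memv_preim; apply: (subvP _ _ uL); apply: mxspace_pow_sub.
  move=> s <- sL; rewrite -memv_preim rmulE.
  pose f := linfun (mulmx (word s) : 'M[F]_D -> 'M[F]_D).
  rewrite (_ : _ *m v = f v); last by rewrite lfunE.
  rewrite memv_preim; apply: (subvP _ _ vL); apply: mxspace_pow_sub => t <- tL.
  rewrite -memv_preim lfunE /= -size_cat (_ : _ *m _ = word (s ++ t)).
    by apply: mxspace_pow_word => x; rewrite mem_cat => /orP [/sL|/tL].
  by rewrite /word big_cat.
apply: mxspace_pow_sub => s size_s sL.
rewrite -(cat_take_drop a s) /word big_cat /=.
have ta : size (take a s) = a by rewrite size_takel // size_s leq_addr.
have db : size (drop a s) = b by rewrite size_drop size_s addKn.
apply: memv_mxprod.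
  have := @mxspace_pow_word _ _ L (take a s); rewrite ta; apply.
  by move=> x /mem_take /sL.
have := @mxspace_pow_word _ _ L (drop a s); rewrite db; apply.
by move=> x /mem_drop /sL.
Qed.

Lemma mxspace_powM (F : fieldType) (D : nat) (L : {vspace 'M[F]_D}) (a b : nat)
    (A B : 'M[F]_D) :
  A \in mxspace_pow L a -> B \in mxspace_pow L b ->
  A *m B \in mxspace_pow L (a + b).
Proof. by move=> AL BL; rewrite -mxspace_powD memv_mxprod. Qed.

Lemma mxspace_powX (F : fieldType) (D : nat) (L : {vspace 'M[F]_D}) (a n : nat)
    (A : 'M[F]_D) :
  A \in mxspace_pow L a -> A ^+ n \in mxspace_pow L (a * n).
Proof.
move=> AL; elim: n => [|n IH]; first by rewrite muln0 mxspace_pow0.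
by rewrite exprS mulnS mxspace_powM.
Qed.

(** Fullness of [L ^ k] with [0 < k] forces [L] times all matrices to be all
    matrices. *)
Lemma mxspace_pow_full_mono (F : fieldType) (D : nat) (L : {vspace 'M[F]_D})
    (k l : nat) :
  (0 < k)%N -> (k <= l)%N -> mxspace_pow L k = fullv -> mxspace_pow L l = fullv.
Proof.
move=> k0 /subnK <- full_k; elim: (l - k)%N => // j IH.
have L1 : mxprodv (mxspace_pow L 1) fullv = fullv :> {vspace 'M[F]_D}.
  apply/eqP; rewrite eqEsubv subvf -[X in (X <= _)%VS]full_k -(prednK k0) -add1n.
  by rewrite -mxspace_powD mxprodvS ?subvf.
by rewrite addSn -add1n -mxspace_powD IH.
Qed.

(** * Row spaces *)

Definition rowspace {F : fieldType} {n p : nat} (A : 'M[F]_(n, p)) :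
    {vspace 'rV[F]_p} :=
  (rmul 1 A @: fullv)%VS.

Lemma rowspaceM (F : fieldType) (n p q : nat) (A : 'M[F]_(n, p)) (B : 'M[F]_(p, q)) :
  rowspace (A *m B) = (rmul 1 B @: rowspace A)%VS.
Proof. exact: rmul_comp. Qed.

Lemma mem_rowspace (F : fieldType) (n p : nat) (A : 'M[F]_(n, p)) (v : 'rV_n) :
  v *m A \in rowspace A.
Proof. by rewrite -rmulE memv_img ?memvf. Qed.

Lemma rowspaceMl (F : fieldType) (n p q : nat) (A : 'M[F]_(n, p)) (B : 'M[F]_(p, q)) :
  (rowspace (A *m B) <= rowspace B)%VS.
Proof.
by apply/subvP => _ /memv_imgP [v _ ->]; rewrite rmulE mulmxA mem_rowspace.
Qed.

Lemma rowspace_eq0 (F : fieldType) (n p : nat) (A : 'M[F]_(n, p)) :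
  (rowspace A == 0%VS) = (A == 0).
Proof.
apply/eqP/eqP => [A0|->].
  apply/row_matrixP => i; rewrite row0 rowE; apply/eqP.
  by rewrite -memv0 -A0 mem_rowspace.
apply/eqP; rewrite -subv0; apply/subvP => _ /memv_imgP [v _ ->].
by rewrite rmulE mulmx0 mem0v.
Qed.

Lemma dim_rowspaceM (F : fieldType) (n p q : nat) (A : 'M[F]_(n, p)) (B : 'M[F]_(p, q)) :
  (\dim (rowspace A :&: lker (rmul 1 B)) + \dim (rowspace (A *m B)))%N
    = \dim (rowspace A).
Proof. by rewrite rowspaceM limg_ker_dim. Qed.

(** If multiplying by [B] does not lower the rank of [A], the row space of [A]
    avoids the kernel of [B]; as the rows of [X *m A] lie in that row space,
    right multiplication by [B] is injective on the matrices [X *m A]. *)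
Lemma dim_rmul_inj (F : fieldType) (m n p q : nat) (A : 'M[F]_(n, p)) (B : 'M[F]_(p, q))
    (V : {vspace 'M[F]_(m, n)}) :
  \dim (rowspace (A *m B)) = \dim (rowspace A) ->
  \dim (rmul m B @: (rmul m A @: V)) = \dim (rmul m A @: V).
Proof.
move=> eqd; apply: limg_dim_eq; apply/eqP; rewrite -subv0; apply/subvP => X.
rewrite memv_cap => /andP [/memv_imgP [Y _ ->]]; rewrite memv_ker !rmulE => /eqP YAB0.
have /eqP ker0 : (rowspace A :&: lker (rmul 1 B))%VS == 0%VS.
  by rewrite -dimv_eq0 -(eqn_add2r (\dim (rowspace (A *m B)))) dim_rowspaceM eqd.
rewrite memv0; apply/eqP/row_matrixP => i; rewrite row0 row_mul; apply/eqP.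
by rewrite -memv0 -ker0 memv_cap mem_rowspace memv_ker rmulE -!row_mul YAB0 row0 /=.
Qed.

Lemma expmxS (F : fieldType) (D t : nat) (z : 'M[F]_D) : z ^+ t.+1 = z *m z ^+ t.
Proof. exact: exprS. Qed.

Lemma expmxSr (F : fieldType) (D t : nat) (z : 'M[F]_D) : z ^+ t.+1 = z ^+ t *m z.
Proof. exact: exprSr. Qed.

Lemma mulmxXC (F : fieldType) (D t : nat) (z : 'M[F]_D) :
  z ^+ t *m z = z *m z ^+ t.
Proof. by rewrite -expmxSr expmxS. Qed.

(** * Spreading a non-nilpotent element *)

(** Otherwise the rank would drop at each of the exponents from [2] to [r + 1]
    and [z ^+ (2 + r)] would vanish.  Starting at [2] matters: in the descent
    only the rank of the square of the matrix is known to be small. *)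
Lemma exists_stable_power (F : fieldType) (D : nat) (z : 'M[F]_D) (r : nat) :
  (forall i, z ^+ i != 0) -> (\dim (rowspace (z ^+ 2)) <= r)%N ->
  exists2 t, (1 < t <= r.+1)%N &
    \dim (rowspace (z ^+ t *m z)) = \dim (rowspace (z ^+ t)).
Proof.
move=> z_neq0 rk2; apply: contrapT => unstable.
suff decr i : (i <= r)%N -> (\dim (rowspace (z ^+ (2 + i))) + i <= r)%N.
  have : \dim (rowspace (z ^+ (2 + r))) = 0%N by have := decr r (leqnn r); lia.
  by move/eqP; rewrite dimv_eq0 rowspace_eq0 (negPf (z_neq0 _)).
elim: i => [|i IH] lt_ir; first by rewrite addn0.
have := IH (ltnW lt_ir); have := dim_rowspaceM (z ^+ (2 + i)) z.
suff : \dim (rowspace (z ^+ (2 + i) *m z)) <> \dim (rowspace (z ^+ (2 + i))).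
  have -> : z ^+ (2 + i.+1) = z ^+ (2 + i) *m z by rewrite addnS exprSr.
  lia.
by move=> eqd; apply: unstable; exists (2 + i)%N => //; lia.
Qed.

(** Columns times the row space of [z ^+ t] is the left ideal that [z ^+ t]
    generates.  The spaces [P (m * n) *m z ^+ t] inside it have nondecreasing
    dimension, as [Q n *m z] lies in [Q n.+1]. *)
Lemma left_ideal_saturates (F : fieldType) (D : nat) (L : {vspace 'M[F]_D}) (m t k0 : nat)
    (z : 'M[F]_D) :
  (0 < k0)%N -> mxspace_pow L k0 = fullv -> (0 < m)%N ->
  z \in mxspace_pow L m ->
  \dim (rowspace (z ^+ t *m z)) = \dim (rowspace (z ^+ t)) ->
  z ^+ t != 0 ->
  (rmul D (z ^+ t) @: mxspace_pow L (m * (D * \dim (rowspace (z ^+ t))).-1)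
    = mxprodv (fullv : {vspace 'cV[F]_D}) (rowspace (z ^+ t)))%VS.
Proof.
move=> k0_gt0 full m0 zL stable zt_neq0.
pose Q n := (rmul D (z ^+ t) @: mxspace_pow L (m * n))%VS.
have top V : (rmul D (z ^+ t) @: V <= mxprodv (fullv : {vspace 'cV[F]_D}) (rowspace (z ^+ t)))%VS.
  by rewrite mxprodv_rmul mxprodv_colrow limgS ?subvf.
have dimQz n : \dim (rmul D z @: Q n) = \dim (Q n) by apply: dim_rmul_inj.
have Qz n : (rmul D z @: Q n <= Q n.+1)%VS.
  apply/subvP => _ /memv_imgP [_ /memv_imgP [X XL ->] ->]; rewrite !rmulE.
  rewrite -mulmxA mulmxXC.
  by rewrite mulmxA -rmulE memv_img // mulnS addnC mxspace_powM.
have QS n : Q n.+1 = mxprodv (mxspace_pow L m) (Q n).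
  by rewrite mxprodv_rmul mxspace_powD /Q mulnS.
apply/eqP; rewrite eqEdim top.
set B : nat := \dim (mxprodv _ _).
have Q0 : (0 < \dim (Q 0%N))%N.
  rewrite lt0n dimv_eq0 -subv0; apply: contra zt_neq0 => /subvP Q0.
  rewrite -memv0 Q0 // -[X in X \in _]mul1mx -rmulE memv_img // muln0.
  exact: mxspace_pow0.
apply: (growth_saturates (d := fun n => \dim (Q n))) => [n|n eqd||].
- by rewrite -dimQz dimvS.
- have /eqP QzE : (rmul D z @: Q n == Q n.+1)%VS by rewrite eqEdim Qz dimQz eqd leqnn.
  by rewrite (QS n.+1) -QzE mxprodv_rmul -QS !dimQz.
- exists k0; rewrite /Q (@mxspace_pow_full_mono _ _ _ k0 (m * k0)) ?leq_pmull //.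
  by rewrite /B mxprodv_rmul mxprodv_colrow.
- have : (B <= D * \dim (rowspace (z ^+ t)))%N.
    apply: leq_trans (dim_mxprodv _ _) _.
    by rewrite dimvf /= /dim /= muln1.
  lia.
Qed.

(** The row space of [z ^+ t] is stable under [z], so that the spaces it spreads
    to under [P (m * n)] are nested. *)
Lemma row_space_saturates (F : fieldType) (D : nat) (L : {vspace 'M[F]_D}) (m t k0 : nat)
    (z : 'M[F]_D) :
  (0 < k0)%N -> mxspace_pow L k0 = fullv -> (0 < m)%N ->
  z \in mxspace_pow L m ->
  \dim (rowspace (z ^+ t *m z)) = \dim (rowspace (z ^+ t)) ->
  z ^+ t != 0 ->
  mxprodv (rowspace (z ^+ t)) (mxspace_pow L (m * D.-1)) = fullv.
Proof.
move=> k0_gt0 full m0 zL stable zt_neq0.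
pose R n := mxprodv (rowspace (z ^+ t)) (mxspace_pow L (m * n)).
have rowspace_z : (rmul 1 z @: rowspace (z ^+ t))%VS = rowspace (z ^+ t).
  rewrite -rowspaceM; apply/eqP; rewrite eqEdim stable leqnn andbT.
  rewrite mulmxXC.
  exact: rowspaceMl.
have row_neq0 : rowspace (z ^+ t) != 0%VS by rewrite rowspace_eq0.
have Rmono n : (R n <= R n.+1)%VS.
  apply: mxprodv_sub => u X; rewrite -{1}rowspace_z => /memv_imgP [v vR ->] XL.
  by rewrite rmulE -mulmxA memv_mxprod // mulnS mxspace_powM.
have RS n : R n.+1 = mxprodv (R n) (mxspace_pow L m).
  by rewrite -mxprodvA mxspace_powD /R mulnS addnC.
have R0 : (0 < \dim (R 0%N))%N.
  rewrite lt0n dimv_eq0; apply: contra row_neq0; rewrite -!subv0.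
  apply: subv_trans; apply/subvP => u uR; rewrite -[u]mulmx1 memv_mxprod // muln0.
  exact: mxspace_pow0.
apply/eqP; rewrite eqEdim subvf /=.
apply: (growth_saturates (d := fun n => \dim (R n))) => [n|n eqd||].
- exact: dimvS.
- have /eqP RE : R n == R n.+1 by rewrite eqEdim Rmono eqd leqnn.
  by rewrite (RS n.+1) -RE -RS.
- exists k0; rewrite /R (@mxspace_pow_full_mono _ _ _ k0 (m * k0)) ?leq_pmull //.
  by rewrite mxprodv_full.
- rewrite dimvf /= /dim /= mul1n; lia.
Qed.

(** With [s <= r] the rank of [z ^+ t], where [t <= r.+1], the product of
    [P (m * (D * s).-1)], [z ^+ t] and [P (m * D.-1)] is everything; the total
    length is at most [2 * D * r * m] since [D + r <= D * r + 1]. *)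
Lemma full_of_not_nilpotent (F : fieldType) (D : nat) (L : {vspace 'M[F]_D})
    (m r k0 : nat) (z : 'M[F]_D) :
  (0 < k0)%N -> mxspace_pow L k0 = fullv -> (0 < m)%N ->
  z \in mxspace_pow L m -> (forall i, z ^+ i != 0) ->
  (\dim (rowspace (z ^+ 2)) <= r)%N ->
  mxspace_pow L (2 * D * r * m) = fullv.
Proof.
move=> k0_gt0 full m0 zL z_neq0 rk2.
have [t /andP [t1 tr] stable] := exists_stable_power z_neq0 rk2.
have colg := left_ideal_saturates k0_gt0 full m0 zL stable (z_neq0 t).
have rowg := row_space_saturates k0_gt0 full m0 zL stable (z_neq0 t).
set rt := \dim (rowspace (z ^+ t)) in colg.
have rt_gt0 : (0 < rt)%N by rewrite lt0n dimv_eq0 rowspace_eq0.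
have rt_le : (rt <= r)%N.
  apply: leq_trans rk2; rewrite /rt -(subnK t1) exprD.
  exact/dimvS/rowspaceMl.
have D0 : (0 < D)%N.
  by apply: leq_trans rt_gt0 _; have := dimvS (subvf (rowspace (z ^+ t))); rewrite dimvf /dim /= mul1n.
set n := (m * (D * rt).-1 + (m * t + m * D.-1))%N.
have n_gt0 : (0 < n)%N by rewrite /n; nia.
apply: (@mxspace_pow_full_mono _ _ _ n) => //.
  have le_Drt : (D * rt <= D * r)%N by rewrite leq_mul2l rt_le orbT.
  have le_Dr : (D + r <= D * r + 1)%N by nia.
  rewrite /n -!mulnDr [(2 * D * r * m)%N]mulnC leq_pmul2l //; nia.
apply/eqP; rewrite eqEsubv subvf /= -(mxprodv_colrow F D) -rowg mxprodvA -colg.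
apply: mxprodv_sub => _ Y /memv_imgP [X XL ->] YL.
by rewrite rmulE -mulmxA !mxspace_powM ?mxspace_powX.
Qed.

(** * Descent to low rank *)

(** The products span [mxspace_pow L J]; a single product is wanted because it
    can be cut in two at any place. *)
Lemma exists_nonzero_word (F : fieldType) (D : nat) (L : {vspace 'M[F]_D}) (J : nat)
    (U X : 'M[F]_D) :
  X \in mxspace_pow L J -> U *m X *m U != 0 ->
  exists s, [/\ size s = J, {subset s <= L} & U *m word s *m U != 0].
Proof.
move=> XL; apply: contraNP => none.
pose f := linfun (mulmx U : 'M[F]_D -> 'M[F]_D).
have fE Y : rmul D U (f Y) = U *m Y *m U by rewrite rmulE lfunE.
suff : X \in ((rmul D U \o f)%VF @^-1: 0)%VS.
  by rewrite -memv_preim memv0 comp_lfunE fE.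
apply: (subvP _ _ XL); apply: mxspace_pow_sub => s sJ sL.
rewrite -memv_preim memv0 comp_lfunE fE; apply: contraPT none => UsU.
by rewrite not_notE; exists s.
Qed.

(** [J] is the least length of a return from the row space of [U] to the
    complement of the kernel of [U], and [S i] is what the row space of [U]
    reaches in fewer than [i] steps.  If [w = a *m b] with [a] of length [i],
    then [b *m U] annihilates [S i], since a nonzero value there would give a
    return shorter than [J]; and it maps [S i.+1] onto a space containing the
    rows of [U *m w *m U].  So the rank of [U *m w *m U] is at most the growth
    from [S i] to [S i.+1], for each of the [J.+1] values of [i]. *)
Lemma exists_low_rank_return (F : fieldType) (D : nat) (L : {vspace 'M[F]_D}) (k0 : nat)
    (U : 'M[F]_D) :
  mxspace_pow L k0 = fullv -> U != 0 ->
  exists J w, [/\ w \in mxspace_pow L J, U *m w *m U != 0 &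
    (J.+1 * \dim (rowspace (U *m w *m U)) <= D)%N].
Proof.
move=> full U_neq0.
pose hits J := `[< exists2 X, X \in mxspace_pow L J & U *m X *m U != 0 >].
have [|J /asboolP [X XL UXU] minJ] := @ex_minnP hits.
  (* A generalized inverse of [U] gives a nonzero return of length [k0]. *)
  exists k0; apply/asboolP.
  exists (pinvmx U); first by rewrite full memvf.
  by rewrite mulmxKpV.
have [s [sJ sL UsU]] := exists_nonzero_word XL UXU.
exists J, (word s); split=> //; first by rewrite -sJ mxspace_pow_word.
pose S i := (\sum_(j < i) mxprodv (rowspace U) (mxspace_pow L j))%VS.
suff step i : (i <= J)%N ->
    (\dim (S i) + \dim (rowspace (U *m word s *m U)) <= \dim (S i.+1))%N.
  have grow i : (i <= J.+1)%N ->
      (i * \dim (rowspace (U *m word s *m U)) <= \dim (S i))%N.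
    elim: i => // i IH lt_iJ; rewrite mulSnr.
    by apply: leq_trans (step i lt_iJ); rewrite leq_add2r IH // ltnW.
  apply: leq_trans (grow _ (leqnn _)) _.
  by have := dimvS (subvf (S J.+1)); rewrite dimvf /dim /= mul1n.
move=> le_iJ; pose a := word (take i s); pose b := word (drop i s).
have aL : a \in mxspace_pow L i.
  have := @mxspace_pow_word F D L (take i s); rewrite size_takel ?sJ //; apply.
  by move=> x /mem_take /sL.
have bL : b \in mxspace_pow L (J - i).
  have := @mxspace_pow_word F D L (drop i s); rewrite size_drop sJ; apply.
  by move=> x /mem_drop /sL.
have wordE : word s = a *m b by rewrite /word -[in LHS](cat_take_drop i s) big_cat.
have ker : (S i <= lker (rmul 1 (b *m U)))%VS.
  apply/subv_sumP => j _; apply: mxprodv_sub => _ Y /memv_imgP [v _ ->] YL.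
  rewrite memv_ker !rmulE; apply/eqP.
  have lt_jJ : (j + (J - i) < J)%N by have := ltn_ord j; lia.
  have YbL : Y *m b \in mxspace_pow L (j + (J - i)) by rewrite mxspace_powM.
  suff /eqP E : U *m (Y *m b) *m U == 0.
    by rewrite !mulmxA in E *; rewrite -!mulmxA in E *; rewrite E mulmx0.
  apply: contraLR lt_jJ => UYbU; rewrite -leqNgt; apply: minJ; apply/asboolP.
  by exists (Y *m b).
have SS : (S i <= S i.+1)%VS by rewrite /S big_ord_recr addvSl.
have img : (rowspace (U *m word s *m U) <= rmul 1 (b *m U) @: S i.+1)%VS.
  apply/subvP => _ /memv_imgP [v _ ->]; rewrite rmulE wordE.
  rewrite (_ : v *m _ = v *m U *m a *m (b *m U)); last by rewrite !mulmxA.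
  rewrite -(@rmulE _ _ _ _ (b *m U)) memv_img // /S big_ord_recr /=.
  by apply: (subvP (addvSr _ _)); rewrite memv_mxprod // mem_rowspace.
rewrite -(limg_ker_dim (rmul 1 (b *m U)) (S i.+1)) leq_add ?dimvS //.
by rewrite subv_cap SS.
Qed.

(** With [y = w *m U], the matrix [U *m y ^+ p] also equals
    [(U *m w) ^+ (p - i) *m (U *m y ^+ i)], so its row space lies in that of
    [U *m y ^+ i]; and [y] annihilates it.  Hence each step from
    [U *m y ^+ i] to [U *m y ^+ i.+1] loses at least the rank of
    [U *m y ^+ p]. *)
Lemma dim_nilpotent_chain (F : fieldType) (D p : nat) (U w : 'M[F]_D) :
  U *m (w *m U) ^+ p.+1 = 0 ->
  forall i, (i <= p)%N ->
    ((p.+1 - i) * \dim (rowspace (U *m (w *m U) ^+ p))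
       <= \dim (rowspace (U *m (w *m U) ^+ i)))%N.
Proof.
set y := w *m U => Uy0.
have Uy i : U *m y ^+ i = (U *m w) ^+ i *m U.
  elim: i => [|i IH]; first by rewrite mulmx1 mul1mx.
  by rewrite !expmxS -mulmxA -IH /y !mulmxA.
have step i : (i <= p)%N ->
    (\dim (rowspace (U *m y ^+ p)) + \dim (rowspace (U *m y ^+ i.+1))
      <= \dim (rowspace (U *m y ^+ i)))%N.
  move=> le_ip; rewrite -(dim_rowspaceM (U *m y ^+ i) y).
  rewrite (_ : U *m y ^+ i *m y = U *m y ^+ i.+1); last by rewrite expmxSr mulmxA.
  rewrite leq_add2r; apply: dimvS; rewrite subv_cap; apply/andP; split.
    rewrite !Uy -{1}(subnK le_ip) exprD -mulmxA; exact: rowspaceMl.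
  apply/subvP => _ /memv_imgP [v _ ->]; rewrite memv_ker !rmulE -!mulmxA.
  by rewrite (_ : y ^+ p *m y = y ^+ p.+1) ?Uy0 ?mulmx0 // expmxSr.
suff main c : (c <= p)%N -> (c.+1 * \dim (rowspace (U *m y ^+ p))
    <= \dim (rowspace (U *m y ^+ (p - c))))%N.
  by move=> i le_ip; have := main (p - i)%N (leq_subr _ _); rewrite subKn // subSn.
elim: c => [|c IH] lt_cp; first by rewrite subn0 mul1n.
have := IH (ltnW lt_cp); have := step (p - c.+1)%N (leq_subr _ _).
rewrite (_ : (p - c.+1).+1 = p - c)%N; last by lia.
rewrite [(c.+2 * _)%N]mulSn; lia.
Qed.

(** Induction on the rank of [U].  The number [e] counts the halvings so far:
    the rank is at most [D / 2 ^ e], and each halving increases the product of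
    length and rank by at most [D]. *)
Lemma full_of_low_rank (F : fieldType) (D : nat) (L : {vspace 'M[F]_D}) (k0 : nat) :
  (0 < k0)%N -> mxspace_pow L k0 = fullv ->
  forall n e k (U : 'M[F]_D), (\dim (rowspace U) <= n)%N ->
    (0 < k)%N -> U \in mxspace_pow L k -> U != 0 ->
    (k * \dim (rowspace U) <= D * e.+1)%N -> (2 ^ e * \dim (rowspace U) <= D)%N ->
  exists2 e', (2 ^ e' <= D)%N & mxspace_pow L (2 * D * (D * (e' + 2))) = fullv.
Proof.
move=> k0_gt0 full; elim=> [|n IH] e k U rkn k_gt0 UL U_neq0 kr er.
  by move: rkn; rewrite leqn0 dimv_eq0 rowspace_eq0 (negPf U_neq0).
have [J [w [wL UwU Jrk]]] := exists_low_rank_return full U_neq0.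
set y := w *m U; have yL : y \in mxspace_pow L (J + k) by rewrite mxspace_powM.
have U_gt0 : (0 < \dim (rowspace U))%N by rewrite lt0n dimv_eq0 rowspace_eq0.
set rho : nat := \dim (rowspace (U *m w *m U)) in Jrk.
have rhoE : rho = \dim (rowspace (U *m y ^+ 1)) by rewrite /rho /y !mulmxA.
have rho_gt0 : (0 < rho)%N by rewrite lt0n dimv_eq0 rowspace_eq0.
have rho_le : (rho <= \dim (rowspace U))%N by apply: dimvS; apply: rowspaceMl.
case: (pselect (forall i, y ^+ i != 0)) => [y_neq0|/existsNP [i /negP/negPn yi0]].
  exists e; first by nia.
  have rk2 : (\dim (rowspace (y ^+ 2)) <= rho)%N.
    rewrite (_ : y ^+ 2 = w *m (U *m w *m U)); last by rewrite expmxS /y !mulmxA.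
    exact/dimvS/rowspaceMl.
  have Jk_gt0 : (0 < J + k)%N by lia.
  have := full_of_not_nilpotent k0_gt0 full Jk_gt0 yL y_neq0 rk2.
  apply: mxspace_pow_full_mono; first by rewrite !muln_gt0; lia.
  rewrite -mulnA leq_mul2l; apply/orP; right; nia.
(* [q] is at least 2, since both [U] and [U *m w *m U] are nonzero. *)
have exq : exists q, U *m y ^+ q == 0 by exists i; rewrite (eqP yi0) mulmx0.
case: (ex_minnP exq) => q /eqP Uq minq.
case: q Uq minq => [|[|p]] Uq minq.
- by move: U_neq0; rewrite -[U]mulmx1 Uq eqxx.
- by move: UwU; rewrite -mulmxA -[w *m U]/(y ^+ 1) Uq eqxx.
have U'_neq0 : U *m y ^+ p.+1 != 0.
  by apply/negP => /minq; rewrite ltnn.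
have chain := dim_nilpotent_chain Uq.
have chain0 := chain 0%N isT; rewrite mulmx1 subn0 in chain0.
have chain1 := chain 1%N isT; rewrite subn1 -rhoE /= in chain1.
set r' : nat := \dim (rowspace _) in chain0 chain1.
have r'_gt0 : (0 < r')%N by rewrite lt0n dimv_eq0 rowspace_eq0.
apply: (IH e.+1 (k + (J + k) * p.+1)%N (U *m y ^+ p.+1)) => //.
- rewrite -/r'; nia.
- lia.
- by rewrite mxspace_powM ?mxspace_powX.
- rewrite -/r'.
  (* Both ranks bound [r']: the first controls the old length [k], the second
     the length [J] of the return. *)
  have H1 : (k * (p.+2 * r') <= k * \dim (rowspace U))%N by rewrite leq_mul2l chain0 orbT.
  have H2 : (J * (p.+1 * r') <= J * rho)%N by rewrite leq_mul2l chain1 orbT.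
  have : ((k + (J + k) * p.+1) * r' = k * (p.+2 * r') + J * (p.+1 * r'))%N by nia.
  by move=> ->; nia.
- rewrite -/r' expnS.
  have : (2 * r' <= \dim (rowspace U))%N by nia.
  by nia.
Qed.

(** * The bound *)

(** The descent starts from any nonzero element of [L], of length one and of
    rank at most [D]. *)
Lemma quantum_wielandt_field (F : fieldType) (D : nat) (L : {vspace 'M[F]_D}) (k0 : nat) :
  (0 < D)%N -> (0 < k0)%N -> mxspace_pow L k0 = fullv ->
  exists2 e, (2 ^ e <= D)%N & mxspace_pow L (2 * D * (D * (e + 2))) = fullv.
Proof.
move=> D_gt0 k0_gt0 full.
have [U UL U_neq0] : exists2 U, U \in mxspace_pow L 1 & U != 0.
  apply: contrapT => none; have L10 : (mxspace_pow L 1 <= 0)%VS.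
    by apply/subvP => X XL; rewrite memv0; apply: contraPT none => X0; rewrite not_notE; exists X.
  have : (1%:M : 'M[F]_D) \in mxspace_pow L k0 by rewrite full memvf.
  rewrite -(prednK k0_gt0) -add1n -mxspace_powD => /(subvP (mxprodvS L10 (subvv _))).
  have /subvP sub0 : (mxprodv 0 (mxspace_pow L k0.-1) <= (0 : {vspace 'M[F]_D}))%VS.
    by apply: mxprodv_sub => u v; rewrite memv0 => /eqP -> _; rewrite mul0mx mem0v.
  move/sub0; rewrite memv0 => /eqP/matrixP/(_ (Ordinal D_gt0) (Ordinal D_gt0)).
  by rewrite !mxE eqxx => /eqP; rewrite oner_eq0.
have rkU : (\dim (rowspace U) <= D)%N.
  by have := dimvS (subvf (rowspace U)); rewrite dimvf /dim /= mul1n.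
by apply: (@full_of_low_rank _ _ _ _ k0_gt0 full D 0%N 1%N U); rewrite ?mul1n ?muln1.
Qed.

Unset Implicit Arguments.

Theorem mainTheorem1 (R : realType) (D : nat) (hD : (1 <= D)%N)
    (L : {vspace 'M[complex R]_D})
    (hL : exists k : nat, (0 < k)%N /\ \dim (mxspace_pow L k) = (D ^ 2)%N) :
  forall k : nat,
    2 * D%:R ^+ 2 * (6 + log2 (D%:R : R)) <= (k%:R : R) ->
    \dim (mxspace_pow L k) = (D ^ 2)%N.
Proof.
have dim_full : \dim (fullv : {vspace 'M[complex R]_D}) = (D ^ 2)%N by rewrite dimvf /dim /= mulnn.
case: hL => k0 [k0_gt0 dim_k0] k hk.
have full : mxspace_pow L k0 = fullv.
  by apply/eqP; rewrite eqEdim subvf dim_full dim_k0 leqnn.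
have [e le_eD fulle] := quantum_wielandt_field hD k0_gt0 full.
rewrite (@mxspace_pow_full_mono _ _ _ _ k _ _ fulle) //; first by rewrite !muln_gt0; lia.
have ln2_gt0 : 0 < ln (2 : R) by rewrite ln_gt0 // ltr1n.
have D_gt0 : 0 < (D%:R : R) by rewrite ltr0n.
have e_le : e%:R <= log2 (D%:R : R).
  rewrite /log2 ler_pdivlMr // mulr_natl -lnXn ?ltr0n //.
  by rewrite ler_ln ?posrE ?exprn_gt0 ?ltr0n // -natrX ler_nat.
rewrite -(ler_nat R); apply: le_trans hk; rewrite !natrM natrD expr2 !mulrA.
by rewrite ler_pM2l ?mulr_gt0 //; lra.
Qed.
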